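(* Let $p$ be a prime and let $r\ge1$, $s\ge 1$, $\lambda\ge0$ be integers. The number of mutually non-isomorphic rings with property (T) and of characteristic $p$, with the same invariants $p,n,r,s,t,\lambda$, where $t=s^2$, is $$\binom{r+s-1}{s}\cdot\binom{r+\lambda-1}{\lambda}.$$ All of these rings are non-commutative.
   Context: All rings are finite, associative, with identity. A finite ring $R$ has property (T) if the set $M$ of all its zero-divisors (including $0$) is an ideal (so $R$ is completely primary with Jacobson radical $M$), $M^3=0$ and $M^2\ne 0$. Compatible matrices: for a finite field $F$, matrices $A_k=(a^k_{ij})\in M_s(F)$, $1\le k\le t$, are called compatible if they are linearly independent over $F$ and for each $i\in\{1,\dots,s\}$ there are $j,k$ with $a^k_{ij}\ne0$ or $a^k_{ji}\neq 0$. Construction A: let $F=GF(p^r)$, $s\ge1$, $1\le t\le s^2$, $\lambda\ge0$. Take compatible matrices $A_1,\dots,A_t\in M_s(F)$, $A_k=(a_{ij}^k)$, and automorphisms $\sigma_1,\dots,\sigma_s,\theta_1,\dots,\theta_{t+\lambda}\in \mathrm{Aut}(F)$ (repetitions allowed) such that for $1\le k\le t$, $a^k_{ij}\neq 0$ implies $\theta_k=\sigma_i\sigma_j$. Put $a^k_{ij}=0$ for $k>t$. Let $U$ and $N$ be $F$-vector spaces with bases $u_1,\dots,u_s$ and $w_1,\dots,w_{t+\lambda}$. The ring of Construction A is the additive group $F\oplus U\oplus N$ with multiplication $$\Big(\alpha_0,\sum_i\alpha_iu_i,\sum_k\gamma_kw_k\Big)\Big(\alpha_0',\sum_i\alpha_i'u_i,\sum_k\gamma_k'w_k\Big)=\Big(\alpha_0\alpha_0',\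 \sum_i[\alpha_0\alpha_i'+\alpha_i(\alpha_0')^{\sigma_i}]u_i,\ \sum_k\big[\alpha_0\gamma_k'+\gamma_k(\alpha_0')^{\theta_k}+\sum_{i,j=1}^s a^k_{ij}\alpha_i(\alpha_j')^{\sigma_i}\big]w_k\Big).$$ The rings with property (T) and characteristic $p$ are, up to isomorphism, exactly the rings of Construction A. A ring is said to have invariants $p,n,r,s,t,\lambda$ if it is isomorphic to a ring of Construction A with these parameters, where $n=1+s+t+\lambda$ (so its order is $p^{nr}$).
   Formalization: ''All of these rings are non-commutative'' fails for s=1 (e.g. F_p[x]/(x^3) with r=1, λ=0); it is proved for s>1, and for s=1 for all rings except one isomorphism class, which is shown to be commutative. *)

(* Defs.v *)
From HB Require Import structures.
From mathcomp Require Import all_boot all_order all_fingroup all_algebra.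

Set Implicit Arguments.
Unset Strict Implicit.
Unset Printing Implicit Defensive.

Import GRing.Theory.
Local Open Scope ring_scope.

Definition ring_iso (R S : finNzRingType) : Prop :=
  exists f : {rmorphism R -> S}, bijective f.

Definition noncommutative (R : finNzRingType) : Prop :=
  ~ commutative (@GRing.mul R).

(* One-sided zero-divisors count; 0 is a zero-divisor because 1 != 0. *)
Definition zero_divisors (R : finNzRingType) : {set R} :=
  [set x | [exists y, (y != 0) && ((x * y == 0) || (y * x == 0))]].

Definition is_ideal (R : finNzRingType) (I : {set R}) : Prop :=
  [/\ 0 \in I,
      {in I &, forall x y, x - y \in I}
    & forall a x, x \in I -> (a * x \in I) /\ (x * a \in I)].

(* The ideal M ^ k is additively generated by the k-fold products of elements
   of M, so it is zero exactly when all these products vanish. *)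
Definition property_T (R : finNzRingType) : Prop :=
  let M := zero_divisors R in
  [/\ is_ideal M,
      {in M & M & M, forall x y z, x * y * z = 0}
    & exists x y, [/\ x \in M, y \in M & x * y != 0]].

Definition compatible (F : finFieldType) (s t : nat) (A : 'I_t -> 'M[F]_s)
  : Prop :=
  free [tuple A k | k < t] /\
  forall i, exists j k, (A k i j != 0) \/ (A k j i != 0).

(* Ring endomorphisms of F stand for Aut(F) below. *)
Lemma finField_rmorph_bij (F : finFieldType) (f : {rmorphism F -> F}) :
  bijective f.
Proof. by apply: injF_bij; apply: fmorph_inj. Qed.

(* The automorphisms theta_1, ..., theta_t are the values of cA_theta at
   lshift lam k, k < t. *)
Record constrA_data (F : finFieldType) (s t lam : nat) := ConstrAData {
  cA_mx : 'I_t -> 'M[F]_s;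
  cA_sigma : 'I_s -> {rmorphism F -> F};
  cA_theta : 'I_(t + lam) -> {rmorphism F -> F};
  cA_compatible : compatible cA_mx;
  cA_thetaE : forall k i j, cA_mx k i j != 0 ->
    cA_theta (lshift lam k) =1 cA_sigma i \o cA_sigma j
}.

(* F (+) U (+) N, with U and N given by coordinates. *)
Definition constrA (F : finFieldType) (s t lam : nat)
  (D : constrA_data F s t lam) : Type :=
  (F * 'rV[F]_s * 'rV[F]_(t + lam))%type.

HB.instance Definition _ F s t lam (D : constrA_data F s t lam) :=
  Finite.copy (constrA D) (F * 'rV[F]_s * 'rV[F]_(t + lam))%type.
HB.instance Definition _ F s t lam (D : constrA_data F s t lam) :=
  GRing.Zmodule.copy (constrA D) (F * 'rV[F]_s * 'rV[F]_(t + lam))%type.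

Section ConstructionA.

Variables (F : finFieldType) (s t lam : nat) (D : constrA_data F s t lam).
Local Notation sigma := (cA_sigma D).
Local Notation theta := (cA_theta D).

Definition cA_coef (k : 'I_(t + lam)) (i j : 'I_s) : F :=
  match split k with
  | inl k' => cA_mx D k' i j
  | inr _ => 0
  end.

Definition cA_one : constrA D := (1, 0, 0).

Definition cA_mul (x y : constrA D) : constrA D :=
  let: (a, u, w) := x in
  let: (a', u', w') := y in
  (a * a',
   \row_i (a * u' 0 i + u 0 i * sigma i a'),
   \row_k (a * w' 0 k + w 0 k * theta k a'
           + \sum_i \sum_j cA_coef k i j * u 0 i * sigma i (u' 0 j))).

Lemma cA_coef_theta k i j a :
  cA_coef k i j * theta k a = cA_coef k i j * sigma i (sigma j a).
Proof.
rewrite /cA_coef; case: splitP => [k' ek|k' _]; last by rewrite !mul0r.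
have [->|nz] := eqVneq (cA_mx D k' i j) 0; first by rewrite !mul0r.
have -> : k = lshift lam k' by apply: val_inj.
by rewrite (cA_thetaE nz).
Qed.

Lemma cA_mulA : associative cA_mul.
Proof.
move=> [[a u] w] [[b v] z] [[c x] y]; rewrite /cA_mul.
congr (_, _, _); first by rewrite mulrA.
  apply/rowP=> i; rewrite !mxE rmorphM !(mulrDr, mulrDl) !mulrA.
  by rewrite addrA.
apply/rowP=> k; rewrite !mxE rmorphM.
set S1 := (X in _ = _ + X).
rewrite !mulrDr !mulrDl !mulrA -!addrA; congr (_ + _); congr (_ + _).
rewrite addrCA; congr (_ + _).
have -> : S1 =
    a * (\sum_i \sum_j cA_coef k i j * v 0 i * sigma i (x 0 j)) +
    \sum_i \sum_j cA_coef k i j * u 0 i * sigma i b * sigma i (x 0 j).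
  rewrite mulr_sumr -big_split; apply: eq_bigr => i _.
  rewrite mulr_sumr -big_split; apply: eq_bigr => j _ /=.
  rewrite !mxE mulrDr mulrDl !mulrA; congr (_ + _).
  by rewrite [cA_coef k i j * a]mulrC.
rewrite addrCA; congr (_ + _).
rewrite mulr_suml -big_split; apply: eq_bigr => i _ /=.
rewrite mulr_suml -big_split; apply: eq_bigr => j _ /=.
rewrite !mxE rmorphD !rmorphM mulrDr !mulrA addrC; congr (_ + _).
set e := cA_coef k i j; set ui := u 0 i; set vj := sigma i (v 0 j).
have -> : e * ui * vj * theta k c = e * theta k c * (ui * vj).
  by rewrite -!mulrA; congr (_ * _); rewrite [RHS]mulrC !mulrA.
rewrite cA_coef_theta -!mulrA; congr (_ * _).
by rewrite [RHS]mulrC !mulrA.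
Qed.

Lemma cA_mul1 : left_id cA_one cA_mul.
Proof.
move=> [[a u] w]; rewrite /cA_mul /cA_one.
congr (_, _, _); first by rewrite mul1r.
  by apply/rowP=> i; rewrite !mxE mul1r mul0r addr0.
apply/rowP=> k; rewrite !mxE mul1r mul0r addr0 big1 ?addr0 // => i _.
by rewrite big1 // => j _; rewrite mxE mulr0 mul0r.
Qed.

Lemma cA_mulr1 : right_id cA_one cA_mul.
Proof.
move=> [[a u] w]; rewrite /cA_mul /cA_one.
congr (_, _, _); first by rewrite mulr1.
  by apply/rowP=> i; rewrite !mxE rmorph1 mulr1 mulr0 add0r.
apply/rowP=> k; rewrite !mxE rmorph1 mulr1 mulr0 add0r big1 ?addr0 // => i _.
by rewrite big1 // => j _; rewrite mxE rmorph0 mulr0.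
Qed.

Lemma cA_mulDl : left_distributive cA_mul +%R.
Proof.
move=> [[a u] w] [[b v] z] [[c x] y]; rewrite /cA_mul.
congr (_, _, _); first by rewrite mulrDl.
  by apply/rowP=> i; rewrite !mxE !mulrDl addrACA.
apply/rowP=> k; rewrite !mxE !mulrDl [RHS]addrACA [X in _ = X + _]addrACA.
congr (_ + _); rewrite -big_split; apply: eq_bigr => i _ /=.
rewrite -big_split; apply: eq_bigr => j _ /=.
by rewrite mxE mulrDr mulrDl.
Qed.

Lemma cA_mulDr : right_distributive cA_mul +%R.
Proof.
move=> [[a u] w] [[b v] z] [[c x] y]; rewrite /cA_mul.
congr (_, _, _); first by rewrite mulrDr.
  by apply/rowP=> i; rewrite !mxE rmorphD !mulrDr addrACA.
apply/rowP=> k; rewrite !mxE rmorphD !mulrDr [RHS]addrACA.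
rewrite [X in _ = X + _]addrACA.
congr (_ + _); rewrite -big_split; apply: eq_bigr => i _ /=.
rewrite -big_split; apply: eq_bigr => j _ /=.
by rewrite mxE rmorphD mulrDr.
Qed.

Lemma cA_one_neq0 : cA_one != 0.
Proof. by apply/eqP => -[/eqP]; rewrite oner_eq0. Qed.

HB.instance Definition _ := GRing.Zmodule_isNzRing.Build (constrA D)
  cA_mulA cA_mul1 cA_mulr1 cA_mulDl cA_mulDr cA_one_neq0.

End ConstructionA.

Definition has_invariants (R : finNzRingType) (p n r s t lam : nat) : Prop :=
  [/\ (0 < s)%N, (0 < t <= s ^ 2)%N, n = (1 + s + t + lam)%N
    & exists (F : finFieldType) (D : constrA_data F s t lam),
        #|F| = (p ^ r)%N /\ ring_iso R (constrA D)].

Definition T_ring_with_invariants (p n r s t lam : nat) (R : finNzRingType)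
  : Prop :=
  [/\ property_T R, p \in [pchar R] & has_invariants R p n r s t lam].

(* Exactly N isomorphism classes of finite rings satisfy P. *)
Definition iso_class_number (P : finNzRingType -> Prop) (N : nat) : Prop :=
  exists X : 'I_N -> finNzRingType,
    [/\ forall i, P (X i),
        forall i j, ring_iso (X i) (X j) -> i = j
      & forall R, P R -> exists i, ring_iso R (X i)].

(* Main.v *)
Require Import Defs.
From HB Require Import structures.
From mathcomp Require Import all_boot all_order all_fingroup all_algebra.
From mathcomp Require Import all_solvable all_field.

(* When t = s ^ 2 the matrices A_1, ..., A_t form a basis of M_s(F), so a linear
   change of basis in the first t coordinates of N turns them into the matrix
   units E_ij, with theta_(i,j) = sigma_i sigma_j forced. The ring is thus
   determined by the multiset of the sigma_i and the multiset of the last lam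
   theta_k, all of them powers x |-> x ^ (p ^ e) of Frobenius with e < r.
   Conversely, writing M for the set of elements of cube zero (the radical) and
   Ann M for its left annihilator (which is N), the numbers of x in M with
   x a - a ^ (p ^ e) x in Ann M for all a, and of x in Ann M with
   x a = a ^ (p ^ e) x for all a, are ring invariants; they are powers of #|F|
   whose exponents reveal the multiplicity of e among the sigma_i, respectively
   among all the theta_k, hence both multisets. *)

Set Implicit Arguments.
Unset Strict Implicit.
Unset Printing Implicit Defensive.

Import GRing.Theory.
Local Open Scope ring_scope.

(** * Finite fields *)

Section FrobeniusPower.

Variables (F : finFieldType) (p : nat) (charFp : p \in [pchar F]).

Definition frob_pow (e : nat) (x : F) : F := x ^+ (p ^ e).

Lemma frob_pow_zmod_morphism e : zmod_morphism (frob_pow e).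
Proof.
have pnat_pe : [pchar F].-nat (p ^ e)%N.
  rewrite (eq_pnat _ (pcharf_eq charFp)) pnatX pnat_id ?orTb //.
  exact: pcharf_prime charFp.
move=> x y; rewrite /frob_pow exprDn_pchar //; congr (_ + _).
(* The sign is handled without splitting on the parity of [p]: [(- y) ^+ (p ^ e)] and [y ^+ (p ^ e)]
   add up to [0 ^+ (p ^ e)], which is 0. *)
apply: (addIr (y ^+ (p ^ e))); rewrite -exprDn_pchar // !addNr expr0n.
by rewrite eqn0Ngt expn_gt0 prime_gt0 // (pcharf_prime charFp).
Qed.

Lemma frob_pow_monoid_morphism e : monoid_morphism (frob_pow e).
Proof. by split=> [|x y]; rewrite /frob_pow ?expr1n // exprMn. Qed.

HB.instance Definition _ e :=
  GRing.isZmodMorphism.Build F F (frob_pow e) (frob_pow_zmod_morphism e).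
HB.instance Definition _ e :=
  GRing.isMonoidMorphism.Build F F (frob_pow e) (frob_pow_monoid_morphism e).

Definition frob e : {rmorphism F -> F} := frob_pow e.

Lemma frobE e x : frob e x = x ^+ (p ^ e).
Proof. by []. Qed.

End FrobeniusPower.

Lemma finField_generator (F : finFieldType) :
  exists x : F, forall y : F, y != 0 -> exists k, y = x ^+ k.
Proof.
have /cyclicP[u Du] := field_unit_group_cyclic [set: {unit F}].
exists (val u) => y y0.
have Uy : y \is a GRing.unit by rewrite unitfE.
have /cycleP[k Dk] : FinRing.unit F Uy \in <[u]>%g by rewrite -Du inE.
by exists k; rewrite -FinRing.val_unitX -Dk.
Qed.

(** The images of 0, ..., p - 1 are already [p] distinct roots of ['X^p - 'X], so one more root [c]
    would exceed the degree. *)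
Lemma fixed_pth_power (F : finFieldType) p (charFp : p \in [pchar F]) (c : F) :
  c ^+ p = c -> exists n, c = n%:R.
Proof.
move=> cp; have p_pr := pcharf_prime charFp.
have [/existsP[i /eqP ->]|] := boolP [exists i : 'I_p, c == i%:R].
  by exists i.
rewrite negb_exists => /forallP c_nat; exfalso.
pose rs := c :: [seq i%:R | i : 'I_p].
pose P : {poly F} := 'X^p - 'X.
have szP : size P = p.+1.
  by rewrite size_polyDl ?size_polyXn // size_polyN size_polyX ltnS prime_gt1.
have P0 : P != 0 by rewrite -size_poly_eq0 szP.
have natp n : root P n%:R.
  rewrite /root !hornerE -[_ ^+ p]/(pFrobenius_aut charFp n%:R) rmorph_nat.
  by rewrite subrr.
have : (size rs < size P)%N.
  apply: max_poly_roots P0 _ _.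
    rewrite /= /root !hornerE cp subrr eqxx /=.
    by apply/allP=> _ /mapP[i _ ->]; exact: natp.
  rewrite /rs /=; apply/andP; split.
    by apply/mapP=> -[i _ Dc]; have := c_nat i; rewrite Dc eqxx.
  rewrite map_inj_uniq ?enum_uniq // => i j /eqP.
  wlog le_ij : i j / (i <= j)%N => [IH|].
    case/orP: (leq_total i j) => [/IH//|/IH IH' /eqP ij]; apply/esym/IH'.
    by rewrite ij.
  rewrite eq_sym -subr_eq0 -natrB // -(dvdn_pcharf charFp) => dvd_p.
  apply/eqP; rewrite eq_sym -val_eqE /= eqn_leq le_ij andbT -subn_eq0.
  rewrite -leqn0 leqNgt; apply/negP=> /dvdn_leq/(_ dvd_p).
  by rewrite leqNgt (leq_ltn_trans (leq_subr _ _)).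
by rewrite szP /= size_map size_enum_ord ltnn.
Qed.

(* For a generator x of F^*, the coefficients of prod_(e < r) (X - x ^ (p ^ e))
   are fixed by Frobenius, so they lie in the prime field and are fixed by f;
   hence f maps x to one of the roots x ^ (p ^ e). *)
Lemma finField_endo_frob (F : finFieldType) p r (charFp : p \in [pchar F])
    (f : {rmorphism F -> F}) :
  #|F| = (p ^ r)%N -> exists e : 'I_r, f =1 frob charFp e.
Proof.
move=> cardF; have p_pr := pcharf_prime charFp.
have r_gt0 : (0 < r)%N.
  by case: r cardF => // F1; have := finNzRing_gt1 F; rewrite F1.
have [x genx] := finField_generator F.
pose m := \prod_(e < r) ('X - (frob charFp e x)%:P).
have frob_m : map_poly (pFrobenius_aut charFp) m = m.
  rewrite /m; case: r cardF r_gt0 @m => // r cardF _ /=.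
  (* Frobenius shifts the factors cyclically: the root of the last one becomes [x ^+ #|F| = x], the
     root of the first. *)
  rewrite rmorph_prod big_ord_recr big_ord_recl /= mulrC; congr (_ * _).
    rewrite rmorphB /= map_polyX map_polyC /= pFrobenius_autE (frobE charFp).
    by rewrite -exprM -expnSr -cardF expf_card (frobE charFp).
  apply: eq_bigr => e _; rewrite rmorphB /= map_polyX map_polyC /=.
  by rewrite pFrobenius_autE !(frobE charFp) -exprM -expnSr.
have f_m : map_poly f m = m.
  apply/polyP=> i; rewrite coef_map.
  have [n ->] : exists n, m`_i = n%:R; last exact: rmorph_nat.
  apply: (fixed_pth_power charFp).
  by rewrite -[in RHS]frob_m coef_map.
have : root m (f x).
  rewrite -f_m fmorph_root /root horner_prod.
  apply/prodf_eq0; exists (Ordinal r_gt0) => //.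
  by rewrite -[_ == 0]/(root _ _) root_XsubC (frobE charFp).
rewrite /root horner_prod => /prodf_eq0[e _].
rewrite -[_ == 0]/(root _ _) root_XsubC => /eqP fx.
exists e => y; have [->|/genx[k ->]] := eqVneq y 0; first by rewrite !rmorph0.
by rewrite !rmorphXn fx.
Qed.

(** Otherwise all [p ^ r] elements of [F] would be roots of ['X^(p ^ e') - 'X^(p ^ e)], whose degree
    is the larger of the two exponents and hence below [p ^ r]. *)
Lemma frob_inj (F : finFieldType) p r (charFp : p \in [pchar F]) (e e' : 'I_r) :
  #|F| = (p ^ r)%N -> frob charFp e =1 frob charFp e' -> e = e'.
Proof.
move=> cardF; have p_pr := pcharf_prime charFp.
wlog lt_ee' : e e' / (e < e')%N => [IH eq_ee'|].
  have [lt|lt|/val_inj//] := ltngtP e e'; first exact: IH.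
  by apply/esym/IH.
move=> eq_ee'; exfalso.
pose P : {poly F} := 'X^(p ^ e') - 'X^(p ^ e).
have lt_p : (p ^ e < p ^ e')%N by rewrite ltn_exp2l ?prime_gt1.
have szP : size P = (p ^ e').+1.
  by rewrite size_polyDl ?size_polyXn // size_polyN size_polyXn ltnS.
have P0 : P != 0 by rewrite -size_poly_eq0 szP.
have : (size (enum F) < size P)%N.
  apply: max_poly_roots P0 _ (enum_uniq F).
  apply/allP=> y _; rewrite /root !hornerE.
  by have := eq_ee' y; rewrite !(frobE charFp) => ->; rewrite subrr.
by rewrite -cardE cardF szP ltnS leq_exp2l ?prime_gt1 // leqNgt ltn_ord.
Qed.

(* The minimal polynomial over 'F_p of a generator x of F^* divides X^(p^r) - X,
   so it has a root y in K, and P(x) |-> P(y) is well defined. *)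
Lemma finField_card_hom (F K : finFieldType) p r :
  prime p -> #|F| = (p ^ r)%N -> #|K| = (p ^ r)%N ->
  exists f : {rmorphism F -> K}, True.
Proof.
move=> p_pr cardF cardK.
have charF := card_finPcharP cardF p_pr.
have charK := card_finPcharP cardK p_pr.
(* These copies carry the ['F_p]-algebra structure, in which [1%AS] is the prime field. *)
pose F1 := pPrimeCharType charF; pose K1 := pPrimeCharType charK.
pose iF : {rmorphism 'F_p -> F1} := in_alg F1.
pose iK : {rmorphism 'F_p -> K1} := in_alg K1.
have [x genx] := finField_generator F.
pose evF (P : {poly 'F_p}) : F := (map_poly iF P).[x].
pose evK y (P : {poly 'F_p}) : K := (map_poly iK P).[y].
have [y ev0] : exists y, forall P, evF P = 0 -> evK y P = 0.
  have /polyOver1P[m Dm] := minPolyOver 1%AS (x : F1).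
  have mP P : evF P = 0 -> m %| P.
    move=> /eqP; rewrite -[_ == 0]/(root _ _) => rootP.
    rewrite -(dvdp_map iF) -Dm.
    have := @minPoly_dvdp _ F1 1%AS x (map_poly iF P); apply; last exact: rootP.
    by apply/polyOver1P; exists P.
  pose Q : {poly 'F_p} := 'X^(p ^ r) - 'X.
  have mQ : m %| Q.
    apply: mP; rewrite /evF rmorphB /= map_polyXn map_polyX !hornerE.
    by rewrite -cardF expf_card subrr.
  have : map_poly iK m %| \prod_(z : K) ('X - z%:P).
    rewrite -finField_genPoly cardK; move: mQ; rewrite -(dvdp_map iK).
    by rewrite rmorphB /= map_polyXn map_polyX.
  rewrite -big_enum => /dvdp_prod_XsubC[ms].
  rewrite eqp_sym => ms_eq.
  (* A minimal polynomial has positive degree, so the image of [m] over [K] has a linear factor; [y]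
     is the root of the first one. *)
  have : (0 < size (mask ms (enum K)))%N.
    have := size_minPoly 1%AS (x : F1); rewrite Dm !size_map_poly => sz_m.
    have := eqp_size ms_eq; rewrite size_prod_XsubC size_map_poly.
    by rewrite /= sz_m => -[->].
  case: (mask _ _) ms_eq => // y s ms_eq _; exists y => P /mP.
  rewrite -(dvdp_map iK) -(eqp_dvdl _ ms_eq) big_cons => dvdPm.
  apply/eqP; rewrite -[_ == 0]/(root _ _) -dvdp_XsubCl.
  by apply: dvdp_trans dvdPm; rewrite dvdp_mulr.
have evFB P Q : evF (P - Q) = evF P - evF Q by rewrite /evF rmorphB !hornerE.
have evKB P Q : evK y (P - Q) = evK y P - evK y Q
  by rewrite /evK rmorphB !hornerE.
have evFM P Q : evF (P * Q) = evF P * evF Q by rewrite /evF rmorphM !hornerE.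
have evKM P Q : evK y (P * Q) = evK y P * evK y Q
  by rewrite /evK rmorphM !hornerE.
(* Every element of [F] is 0 or a power of [x], hence the value at [x] of 0 or of a monomial. *)
have [g gK] : exists g, forall z, evF (g z) = z.
  apply: (@fin_all_exists F (fun=> {poly 'F_p}) (fun z P => evF P = z)) => z.
  have [->|/genx[k ->]] := eqVneq z 0.
    by exists 0; rewrite /evF rmorph0 horner0.
  by exists 'X^k; rewrite /evF map_polyXn hornerXn.
have eq_ev P Q : evF P = evF Q -> evK y P = evK y Q.
  by move=> eqPQ; apply/subr0_eq; rewrite -evKB ev0 // evFB eqPQ subrr.
pose f z := evK y (g z).
have fB : zmod_morphism f.
  by move=> a b; rewrite /f -evKB; apply: eq_ev; rewrite evFB !gK.
have fM : monoid_morphism f.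
  split=> [|a b]; last by rewrite /f -evKM; apply: eq_ev; rewrite evFM !gK.
  rewrite /f (eq_ev _ 1) ?gK; first by rewrite /evK rmorph1 hornerC.
  by rewrite /evF rmorph1 hornerC.
pose fZ := GRing.isZmodMorphism.Build F K f fB.
pose fR := GRing.isMonoidMorphism.Build F K f fM.
pose f' : {rmorphism F -> K} := HB.pack f fZ fR.
by exists f'.
Qed.

(** * Reduction to matrix units *)

Lemma ring_iso_intro (R S : finNzRingType) (f : R -> S) :
  zmod_morphism f -> monoid_morphism f -> bijective f -> ring_iso R S.
Proof.
move=> fB fM bij_f.
pose fZ := GRing.isZmodMorphism.Build R S f fB.
pose fR := GRing.isMonoidMorphism.Build R S f fM.
pose f' : {rmorphism R -> S} := HB.pack f fZ fR.
by exists f'.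
Qed.

Lemma ring_iso_refl R : ring_iso R R.
Proof. by exists idfun; exists id. Qed.

Lemma ring_iso_sym R S : ring_iso R S -> ring_iso S R.
Proof.
case=> f [g fK gK]; apply: (@ring_iso_intro _ _ g); last by exists f.
  by move=> x y; apply: (can_inj fK); rewrite rmorphB !gK.
split=> [|x y]; apply: (can_inj fK); first by rewrite rmorph1 gK.
by rewrite rmorphM !gK.
Qed.

Lemma ring_iso_trans R S T : ring_iso R S -> ring_iso S T -> ring_iso R T.
Proof. by case=> f bij_f [g bij_g]; exists (g \o f); apply: bij_comp. Qed.

Lemma noncommutative_iso R S :
  ring_iso R S -> noncommutative S -> noncommutative R.
Proof.
case=> f [g fK gK] ncS cR; apply: ncS => x y.
by rewrite -(gK x) -(gK y) -!rmorphM cR.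
Qed.

(** * Construction A with the matrix units as structure matrices *)

Section FullData.

Variables (F : finFieldType) (s lam : nat).
Variables (sg : 'I_s -> {rmorphism F -> F}) (ta : 'I_lam -> {rmorphism F -> F}).

(** The matrix unit E_ij, where [k] is the code [mxvec_index i j] of the pair (i, j). *)
Definition full_mx (k : 'I_(s * s)) : 'M[F]_s := vec_mx (delta_mx 0 k).

Definition mxvec_pair (k : 'I_(s * s)) : 'I_s * 'I_s :=
  enum_val (cast_ord (esym (mxvec_cast s s)) k).

Lemma mxvec_pairK i j : mxvec_pair (mxvec_index i j) = (i, j).
Proof. by rewrite /mxvec_pair /mxvec_index cast_ordK enum_rankK. Qed.

(** On the indices of matrix units the compatibility condition forces sigma_i sigma_j; only the last
    [lam] automorphisms are free. *)
Definition full_theta (k : 'I_(s * s + lam)) : {rmorphism F -> F} :=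
  match split k with
  | inl k' => sg (mxvec_pair k').1 \o sg (mxvec_pair k').2
  | inr l => ta l
  end.

Lemma full_theta_lshift i j :
  full_theta (lshift lam (mxvec_index i j)) =1 sg i \o sg j.
Proof. by move=> x; rewrite /full_theta (unsplitK (inl _)) mxvec_pairK. Qed.

Lemma full_theta_rshift l : full_theta (rshift _ l) = ta l.
Proof. by rewrite /full_theta (unsplitK (inr _)). Qed.

Lemma full_mx_compatible : compatible full_mx.
Proof.
split=> [|i]; last first.
  exists i, (mxvec_index i i); left.
  by rewrite /full_mx vec_mx_delta mxE !eqxx oner_eq0.
apply/freeP=> c c0 k; case/mxvec_indexP: k => i j.
move/matrixP/(_ i j): c0; rewrite summxE mxE => <-.
rewrite (bigD1 (mxvec_index i j)) // -tnth_nth tnth_mktuple mxE.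
rewrite /full_mx vec_mx_delta mxE !eqxx mulr1 big1 => [|k].
  exact/esym/addr0.
rewrite -tnth_nth tnth_mktuple mxE.
case/mxvec_indexP: k => i' j' ne; rewrite vec_mx_delta mxE.
have [ei|] := eqVneq i i'; have [ej|] := eqVneq j j'; rewrite ?mulr0 //.
by rewrite ei ej eqxx in ne.
Qed.

Lemma full_mx_theta k i j : full_mx k i j != 0 ->
  full_theta (lshift lam k) =1 sg i \o sg j.
Proof.
case/mxvec_indexP: k => i' j'; rewrite /full_mx vec_mx_delta mxE.
have [-> /=|] := eqVneq i i'; last by rewrite eqxx.
have [-> _|] := eqVneq j j'; last by rewrite eqxx.
exact: full_theta_lshift.
Qed.

Definition full_data : constrA_data F s (s * s) lam :=
  ConstrAData full_mx_compatible full_mx_theta.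

Lemma full_coef_lshift i' j' i j :
  cA_coef full_data (lshift lam (mxvec_index i' j')) i j
  = ((i == i') && (j == j'))%:R.
Proof. by rewrite /cA_coef (unsplitK (inl _)) /= /full_mx vec_mx_delta mxE. Qed.

Lemma full_coef_rshift l i j : cA_coef full_data (rshift _ l) i j = 0.
Proof. by rewrite /cA_coef (unsplitK (inr _)). Qed.

Implicit Types x y : constrA full_data.

Lemma full_mul1 x y : (x * y).1.1 = x.1.1 * y.1.1.
Proof. by case: x y => [[a u] w] [[b v] z]. Qed.

Lemma full_mulU x y i :
  (x * y).1.2 0 i = x.1.1 * y.1.2 0 i + x.1.2 0 i * sg i y.1.1.
Proof. by case: x y => [[a u] w] [[b v] z]; rewrite mxE. Qed.

(** Only E_ij contributes to the coordinate (i, j), so the double sum collapses to one term: u_i u_j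
    is the basis vector w_(i,j). *)
Lemma full_mulN x y i j (k := lshift lam (mxvec_index i j)) :
  (x * y).2 0 k = x.1.1 * y.2 0 k + x.2 0 k * sg i (sg j y.1.1)
                + x.1.2 0 i * sg i (y.1.2 0 j).
Proof.
case: x y => [[a u] w] [[b v] z]; rewrite mxE /= -/(full_theta k).
rewrite full_theta_lshift; congr (_ + _).
rewrite (bigD1 i) //= (bigD1 j) //= full_coef_lshift !eqxx mul1r.
rewrite !big1 ?addr0 // => [i' ne|j' ne]; last first.
  by rewrite full_coef_lshift (negPf ne) andbF !mul0r.
by rewrite big1 // => j' _; rewrite full_coef_lshift (negPf ne) !mul0r.
Qed.

Lemma full_mulW x y l (k := rshift (s * s) l) :
  (x * y).2 0 k = x.1.1 * y.2 0 k + x.2 0 k * ta l y.1.1.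
Proof.
case: x y => [[a u] w] [[b v] z]; rewrite mxE /= full_theta_rshift.
rewrite big1 ?addr0 // => i _; rewrite big1 // => j _.
by rewrite full_coef_rshift !mul0r.
Qed.

Lemma full_eqP x y :
  [/\ x.1.1 = y.1.1, forall i, x.1.2 0 i = y.1.2 0 i,
      forall i j, x.2 0 (lshift lam (mxvec_index i j))
                = y.2 0 (lshift lam (mxvec_index i j))
    & forall l, x.2 0 (rshift _ l) = y.2 0 (rshift _ l)] <-> x = y.
Proof.
split=> [[]|-> //]; case: x y => [[a u] w] [[b v] z] /= -> eu ew ez.
congr (_, _, _); apply/rowP=> // k.
by case: (split_ordP k) => [k' ->|l ->]; [case/mxvec_indexP: k' | ].
Qed.

End FullData.

(* The form B |-> sum_(i, j) B i j X i j vanishes on a basis of M_s(F). *)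
Lemma spanning_inj (F : fieldType) s (A : 'I_(s * s) -> 'M[F]_s) (X : 'M[F]_s) :
  free [tuple A k | k < s * s] ->
  (forall k, \sum_i \sum_j A k i j * X i j = 0) -> X = 0.
Proof.
move=> freeA AX0; apply/matrixP=> i j; rewrite [RHS]mxE.
(* A free family of s * s matrices is a basis, since s * s is the dimension of M_s(F). *)
have basA : basis_of fullv [tuple A k | k < s * s].
  by rewrite basisEfree freeA subvf dimvf size_tuple /dim /= leqnn.
pose phi (B : 'M[F]_s) := \sum_i \sum_j B i j * X i j.
have phi0 B : phi B = 0.
  rewrite (coord_basis basA (memvf B)) /phi.
  transitivity (\sum_k coord [tuple A k | k < s * s] k B * phi (A k)).
    under eq_bigr => i' _ do under eq_bigr => j' _ do
      rewrite summxE mulr_suml.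
    under eq_bigr => i' _ do rewrite exchange_big.
    rewrite exchange_big; apply: eq_bigr => k _; rewrite mulr_sumr.
    apply: eq_bigr => i' _; rewrite mulr_sumr; apply: eq_bigr => j' _.
    by rewrite mxE -tnth_nth tnth_mktuple mulrA.
  by rewrite big1 // => k _; rewrite [phi _]AX0 mulr0.
rewrite -[RHS](phi0 (delta_mx i j)) /phi (bigD1 i) //= (bigD1 j) //=.
rewrite mxE !eqxx mul1r !big1 ?addr0 // => [i' ne|j' ne].
  by rewrite big1 // => j' _; rewrite mxE (negPf ne) mul0r.
by rewrite mxE (negPf ne) andbF mul0r.
Qed.

(** * Change of basis from the matrix units to arbitrary structure matrices *)

Section FullIso.

Variables (F K : finFieldType) (s lam : nat) (phi : {rmorphism K -> F}).
Hypothesis cardFK : #|K| = #|F|.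
Variables (D : constrA_data F s (s * s) lam).
Variables (sg : 'I_s -> {rmorphism K -> K}) (ta : 'I_lam -> {rmorphism K -> K}).
Variables (pi : 'S_s) (rho : 'S_lam).
Hypothesis sgE : forall i x, cA_sigma D i (phi x) = phi (sg (pi i) x).
Hypothesis taE : forall l x,
  cA_theta D (rshift _ l) (phi x) = phi (ta (rho l) x).

Local Notation R := (constrA (full_data sg ta)).

(** On U the map sends u_(pi i) to u_i, so multiplicativity forces w_(pi i, pi j) to go to u_i u_j,
    that is, to the sum over k of a^k_ij w_k. *)
Definition full_map_N (w : 'rV[K]_(s * s + lam)) : 'rV[F]_(s * s + lam) :=
  \row_k match split k with
  | inl k' => \sum_i \sum_j
      cA_mx D k' i j * phi (w 0 (lshift lam (mxvec_index (pi i) (pi j))))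
  | inr l => phi (w 0 (rshift _ (rho l)))
  end.

Definition full_map (x : R) : constrA D :=
  (phi x.1.1, \row_i phi (x.1.2 0 (pi i)), full_map_N x.2).

Lemma full_map_zmod_morphism : zmod_morphism full_map.
Proof.
move=> x y; congr (_, _, _); first exact: rmorphB.
  by apply/rowP=> i; rewrite !mxE rmorphB.
apply/rowP=> k; rewrite !mxE; case: (split k) => l; last first.
  by rewrite !mxE rmorphB.
rewrite -sumrB; apply: eq_bigr => i _; rewrite -sumrB; apply: eq_bigr => j _.
by rewrite !mxE rmorphB mulrBr.
Qed.

Lemma full_map_monoid_morphism : monoid_morphism full_map.
Proof.
split=> [|x y].
  congr (_, _, _); first exact: rmorph1.
    by apply/rowP=> i; rewrite !mxE rmorph0.
  apply/rowP=> k; rewrite !mxE; case: (split k) => l; last first.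
    by rewrite mxE rmorph0.
  by rewrite big1 // => i _; rewrite big1 // => j _; rewrite mxE rmorph0 mulr0.
congr (_, _, _); first by rewrite full_mul1 rmorphM.
  by apply/rowP=> i; rewrite !mxE full_mulU rmorphD !rmorphM sgE.
apply/rowP=> k; rewrite !mxE; case: (split_ordP k) => [k' ->|l ->].
  rewrite mulr_sumr mulr_suml -!big_split; apply: eq_bigr => i _.
  rewrite /= mulr_sumr mulr_suml -!big_split; apply: eq_bigr => j _.
  rewrite !mxE full_mulN !rmorphD !rmorphM !mulrDr /= -!sgE; congr (_ + _ + _).
  - by rewrite mulrCA.
  - rewrite mulrA [in LHS]mulrAC [in RHS]mulrAC; congr (_ * _).
    (* [cA_theta] is known to be sigma_i sigma_j only where the coefficient is nonzero, so the two
       are compared after multiplication by that coefficient. *)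
    have := cA_coef_theta D (lshift lam k') i j (phi y.1.1).
    by rewrite /cA_coef (unsplitK (inl _)).
  - by rewrite /cA_coef (unsplitK (inl _)) mulrA.
rewrite full_mulW rmorphD !rmorphM taE.
rewrite [X in _ = _ + X]big1 ?addr0 // => i _; rewrite big1 // => j _.
by rewrite /cA_coef (unsplitK (inr _)) !mul0r.
Qed.

(** Both rings have the same cardinality, so a trivial kernel is enough. On the first s * s
    coordinates of N it is trivial because the matrices [cA_mx D k] span M_s(F). *)
Lemma full_map_bij : bijective full_map.
Proof.
apply: inj_card_bij; last first.
  by rewrite !card_prod !card_mx cardFK.
apply: (@raddf_inj _ _ (HB.pack full_map
  (GRing.isZmodMorphism.Build _ _ full_map full_map_zmod_morphism))) => x /=.
case: x => [[a u] w] [/eqP]; rewrite fmorph_eq0 => /eqP -> /rowP u0 /rowP w0.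
apply/full_eqP; split=> //= [i|i j|l]; rewrite mxE;
  apply: (fmorph_inj phi); rewrite rmorph0.
- by have := u0 (pi^-1 i)%g; rewrite !mxE permKV.
- have /matrixP/(_ (pi^-1 i)%g (pi^-1 j)%g) :
    (\matrix_(i, j) phi (w 0 (lshift lam (mxvec_index (pi i) (pi j))))
     : 'M_s) = 0.
    have [freeA _] := cA_compatible D.
    apply: (spanning_inj freeA) => k; have := w0 (lshift lam k).
    rewrite !mxE (unsplitK (inl _)) => w0k.
    rewrite -[RHS]w0k; apply: eq_bigr => i' _; apply: eq_bigr => j' _.
    by rewrite mxE.
  by rewrite !mxE !permKV.
- by have := w0 (rshift _ (rho^-1 l)%g); rewrite !mxE (unsplitK (inr _)) permKV.
Qed.

Lemma full_data_iso : ring_iso R (constrA D).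
Proof.
apply: ring_iso_intro full_map_bij.
  exact: full_map_zmod_morphism.
exact: full_map_monoid_morphism.
Qed.

End FullIso.

(** * Invariants *)

Section Invariants.

Variables (p e : nat).

(** In the rings of interest this is the radical, described by an equation that isomorphisms visibly
    preserve. *)
Definition cube_zero (R : finNzRingType) : {set R} := [set x | x ^+ 3 == 0].

(** The element [a] ranges over the whole ring, so that no copy of the field has to be chosen in it.
    Working modulo the left annihilator discards the products of U with U. *)
Definition twisted_mod_ann (R : finNzRingType) : {set R} :=
  [set x in cube_zero R | [forall a, forall y in cube_zero R,
                            (x * a - a ^+ (p ^ e) * x) * y == 0]].

Definition twisted_in_ann (R : finNzRingType) : {set R} :=
  [set x in cube_zero R | [forall y in cube_zero R, x * y == 0]
                          && [forall a, x * a == a ^+ (p ^ e) * x]].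

Lemma forall_bij (T T' : finType) (f : T -> T') (P : pred T') :
  bijective f -> [forall y, P y] = [forall x, P (f x)].
Proof.
case=> g fK gK; apply/forallP/forallP=> H x; first exact: H.
by rewrite -[x]gK.
Qed.

Section Transport.

Variables (R S : finNzRingType) (f : {rmorphism R -> S}).
Hypothesis bij_f : bijective f.

Let f_eq0 x : (f x == 0) = (x == 0).
Proof. by rewrite -(inj_eq (bij_inj bij_f)) rmorph0. Qed.

Lemma cube_zero_bij x : (f x \in cube_zero S) = (x \in cube_zero R).
Proof. by rewrite !inE -rmorphXn f_eq0. Qed.

Lemma twisted_mod_ann_bij : #|twisted_mod_ann R| = #|twisted_mod_ann S|.
Proof.
rewrite -(on_card_preimset (onW_bij _ bij_f)); apply: eq_card => x.
rewrite !in_set -rmorphXn f_eq0; congr (_ && _).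
rewrite (forall_bij _ bij_f); apply: eq_forallb => a.
rewrite (forall_bij _ bij_f); apply: eq_forallb => y.
by rewrite cube_zero_bij -rmorphXn -!rmorphM -rmorphB -rmorphM f_eq0.
Qed.

Lemma twisted_in_ann_bij : #|twisted_in_ann R| = #|twisted_in_ann S|.
Proof.
rewrite -(on_card_preimset (onW_bij _ bij_f)); apply: eq_card => x.
rewrite !in_set -rmorphXn f_eq0; congr [&& _, _ & _].
  rewrite (forall_bij _ bij_f); apply: eq_forallb => y.
  by rewrite cube_zero_bij -rmorphM f_eq0.
rewrite (forall_bij _ bij_f); apply: eq_forallb => a.
by rewrite -rmorphXn -!rmorphM (inj_eq (bij_inj bij_f)).
Qed.

End Transport.

End Invariants.

Lemma card_row_support (F : finFieldType) m (P : pred 'I_m) :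
  #|[set u : 'rV[F]_m | [forall i, P i || (u 0 i == 0)]]| = (#|F| ^ #|P|)%N.
Proof.
rewrite -(card_pffun_on 0 P (@predT F)).
pose f (u : 'rV[F]_m) := [ffun i => u 0 i].
have f_bij : bijective f.
  exists (fun g : {ffun 'I_m -> F} => \row_i g i) => [u|g].
    by apply/rowP=> i; rewrite mxE ffunE.
  by apply/ffunP=> i; rewrite ffunE mxE.
rewrite -[RHS]cardsE -(on_card_preimset (onW_bij _ f_bij)); apply: eq_card => u.
rewrite !inE; apply/forallP/pffun_onP=> [H|[/subsetP sup _] i].
  split=> //; apply/subsetP=> i; rewrite !inE ffunE => ui.
  by have := H i; rewrite (negPf ui) orbF.
have := sup i; rewrite !inE ffunE; case: (u 0 i == 0); first by rewrite orbT.
by move=> /(_ isT); rewrite unfold_in => ->.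
Qed.

(** * Radical and invariants of the rings given by matrix units *)

Section FullRing.

Variables (F : finFieldType) (s lam : nat).
Variables (sg : 'I_s -> {rmorphism F -> F}) (ta : 'I_lam -> {rmorphism F -> F}).

Local Notation R := (constrA (full_data sg ta)).
Local Notation theta := (full_theta sg ta).
Implicit Types x y : R.

Definition scal_elt (a : F) : R := (a, 0, 0).
Definition u_elt i : R := (0, delta_mx 0 i, 0).
Definition w_elt k : R := (0, 0, delta_mx 0 k).

Lemma full_eq0P x :
  [/\ x.1.1 = 0, forall i, x.1.2 0 i = 0,
      forall i j, x.2 0 (lshift lam (mxvec_index i j)) = 0
    & forall l, x.2 0 (rshift _ l) = 0] <-> x = 0.
Proof.
split=> [[x0 xU xN xW]|->]; last by split=> * /=; rewrite ?mxE.
by apply/full_eqP; split=> * /=; rewrite ?mxE.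
Qed.

(** The bilinear term needs both U parts; without it every coordinate of N, of either kind, is a
    one-dimensional bimodule twisted by [theta k]. *)
Lemma full_mulN0 x y k : x.1.2 = 0 \/ y.1.2 = 0 ->
  (x * y).2 0 k = x.1.1 * y.2 0 k + x.2 0 k * theta k y.1.1.
Proof.
case: x y => [[a u] w] [[b v] z] /= uv0; rewrite mxE big1 ?addr0 // => i _.
rewrite big1 // => j _; case: uv0 => ->; rewrite mxE ?mulr0 ?mul0r //.
by rewrite rmorph0 mulr0.
Qed.

Lemma full_exp1 x n : (x ^+ n).1.1 = x.1.1 ^+ n.
Proof. by elim: n => // n IHn; rewrite !exprS full_mul1 IHn. Qed.

Lemma full_mulrn x n : x *+ n = (x.1.1 *+ n, x.1.2 *+ n, x.2 *+ n).
Proof. by elim: n => // n IHn; rewrite !mulrS IHn. Qed.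

Lemma full_pchar p : p \in [pchar F] -> p \in [pchar R].
Proof.
rewrite !inE => /andP[-> /eqP p0] /=; apply/eqP; rewrite full_mulrn /= p0.
by rewrite !mul0rn.
Qed.

(** A product of two elements with zero field coordinate lies in N, and N is annihilated by such
    elements. *)
Lemma full_mul3 x y z : x.1.1 = 0 -> y.1.1 = 0 -> z.1.1 = 0 -> x * y * z = 0.
Proof.
move=> x0 y0 z0; have xyU : (x * y).1.2 = 0.
  by apply/rowP=> i; rewrite full_mulU x0 y0 rmorph0 mul0r mulr0 addr0 mxE.
apply/full_eq0P; split=> [|i|i j|l].
- by rewrite full_mul1 z0 mulr0.
- by rewrite full_mulU xyU mxE z0 rmorph0 full_mul1 x0 !mul0r addr0.
- rewrite full_mulN0; last by left.
  by rewrite z0 rmorph0 full_mul1 x0 !mul0r mulr0 addr0.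
- rewrite full_mulN0; last by left.
  by rewrite z0 rmorph0 full_mul1 x0 !mul0r mulr0 addr0.
Qed.

(** The field coordinate of a cube is the cube of the field coordinate, and a field has no nonzero
    nilpotents. *)
Lemma full_cube_zero x : (x \in cube_zero R) = (x.1.1 == 0).
Proof.
rewrite inE; apply/eqP/eqP=> [/(congr1 (fun z => z.1.1))|x0]; last first.
  by rewrite !exprS expr0 mulr1 mulrA full_mul3.
by rewrite full_exp1 => /eqP; rewrite expf_eq0 => /andP[_ /eqP].
Qed.

Hypothesis s_gt0 : (0 < s)%N.
Let i0 : 'I_s := Ordinal s_gt0.

Lemma full_mul_uu i j :
  (u_elt i * u_elt j).2 0 (lshift lam (mxvec_index i j)) = 1.
Proof. by rewrite full_mulN /= !mxE !eqxx /= !mul0r !mul1r !add0r rmorph1. Qed.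

(** If the field coordinate of [x] is nonzero, then [x * y = 0] or [y * x = 0] kills the coordinates
    of [y] in F, then in U, then in N. *)
Lemma full_zero_divisors : zero_divisors R = [set x | x.1.1 == 0].
Proof.
apply/setP=> x; rewrite !inE; apply/existsP/eqP=> [[y /andP[y0]]|x0].
  apply: contraTeq => x1; rewrite negb_or; apply/andP.
  split; apply: contraNN y0.
    move=> /eqP/full_eq0P[] /eqP.
    rewrite full_mul1 mulf_eq0 (negPf x1) => /eqP y1 yU.
    have y2 : y.1.2 = 0.
      apply/rowP=> i; have := yU i; rewrite full_mulU y1 rmorph0 mulr0 addr0.
      by move/eqP; rewrite mulf_eq0 (negPf x1) mxE => /eqP.
    move=> yN yW; apply/eqP/full_eq0P; split=> // [i|i j|l].
      by rewrite y2 mxE.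
      have := yN i j; rewrite full_mulN0; last by right.
      rewrite y1 rmorph0 mulr0 addr0 => /eqP.
      by rewrite mulf_eq0 (negPf x1) => /eqP.
    have := yW l; rewrite full_mulW y1 rmorph0 mulr0 addr0 => /eqP.
    by rewrite mulf_eq0 (negPf x1) => /eqP.
  move=> /eqP/full_eq0P[] /eqP.
  rewrite full_mul1 mulf_eq0 (negPf x1) orbF => /eqP y1 yU.
  have y2 : y.1.2 = 0.
    apply/rowP=> i; have := yU i; rewrite full_mulU y1 mul0r add0r.
    by move/eqP; rewrite mulf_eq0 fmorph_eq0 (negPf x1) orbF mxE => /eqP.
  move=> yN yW; apply/eqP/full_eq0P; split=> // [i|i j|l].
    by rewrite y2 mxE.
    have := yN i j; rewrite full_mulN0; last by left.
    rewrite y1 mul0r add0r => /eqP.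
    by rewrite mulf_eq0 fmorph_eq0 (negPf x1) orbF => /eqP.
  have := yW l; rewrite full_mulW y1 mul0r add0r => /eqP.
  by rewrite mulf_eq0 fmorph_eq0 (negPf x1) orbF => /eqP.
(* Conversely, a basis vector of N is annihilated on the left by every element with zero field
   coordinate. *)
pose k0 := lshift lam (mxvec_index i0 i0).
exists (w_elt k0); apply/andP; split.
  apply/eqP=> /(congr1 (fun z : R => z.2 0 k0)) /eqP.
  by rewrite !mxE !eqxx oner_eq0.
apply/orP; left; apply/eqP/full_eq0P; split=> [|i|i j|l].
- by rewrite full_mul1 x0 mul0r.
- by rewrite full_mulU x0 rmorph0 mul0r mulr0 addr0.
- by rewrite full_mulN0; last right; rewrite // x0 rmorph0 mul0r mulr0 addr0.
- by rewrite full_mulN0; last right; rewrite // x0 rmorph0 mul0r mulr0 addr0.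
Qed.

Lemma full_property_T : property_T R.
Proof.
split; rewrite full_zero_divisors.
- split=> [|x y|a x]; rewrite !inE; first by [].
    move=> /eqP x0 /eqP y0.
    by rewrite [(x - y).1.1](_ : _ = x.1.1 - y.1.1) // x0 y0 subr0.
  by move=> /eqP x0; rewrite !full_mul1 x0 mulr0 mul0r.
- by move=> x y z; rewrite !inE => /eqP x0 /eqP y0 /eqP z0; apply: full_mul3.
exists (u_elt i0), (u_elt i0); rewrite !inE eqxx; split=> //.
apply/eqP=> /(congr1 (fun z : R => z.2 0 (lshift lam (mxvec_index i0 i0)))).
by rewrite full_mul_uu mxE => /eqP; rewrite oner_eq0.
Qed.

(** * Computation of the two invariants *)

Section Cardinals.

Variables (p e : nat).

Definition acts_as_frob (f : F -> F) := [forall a, f a == a ^+ (p ^ e)].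

Lemma acts_as_frobPn f :
  reflect (exists a, f a - a ^+ (p ^ e) != 0) (~~ acts_as_frob f).
Proof.
rewrite negb_forall; apply: (iffP existsP) => -[a fa]; exists a.
  by rewrite subr_eq0.
by rewrite -subr_eq0.
Qed.

(** Right multiplication by [u_elt i] copies the i-th coordinate of U into the coordinate (i, i) of
    N, so elements of the radical that annihilate it on the left have zero U part. *)
Lemma full_mul_u x i : x.1.1 = 0 ->
  (x * u_elt i).2 0 (lshift lam (mxvec_index i i)) = x.1.2 0 i.
Proof.
move=> x0; rewrite full_mulN x0 /= !mxE !eqxx /= !rmorph0 mul0r mulr0 !add0r.
by rewrite rmorph1 mulr1.
Qed.

Lemma full_mul_ann x y : x.1.1 = 0 -> x.1.2 = 0 -> y.1.1 = 0 -> x * y = 0.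
Proof.
move=> x0 xU y0; apply/full_eq0P; split=> [|i|i j|l].
- by rewrite full_mul1 x0 mul0r.
- by rewrite full_mulU x0 y0 rmorph0 mul0r mulr0 addr0.
- by rewrite full_mulN0; last left; rewrite // x0 y0 rmorph0 mul0r mulr0 addr0.
- by rewrite full_mulN0; last left; rewrite // x0 y0 rmorph0 mul0r mulr0 addr0.
Qed.

Definition twist x y : R := x * y - y ^+ (p ^ e) * x.

Lemma full_twist1 x y : x.1.1 = 0 -> (twist x y).1.1 = 0.
Proof.
move=> x0; transitivity ((x * y).1.1 - (y ^+ (p ^ e) * x).1.1) => //.
by rewrite !full_mul1 x0 mul0r mulr0 subr0.
Qed.

(** The U parts of [y] and of its power meet only [x.1.1 = 0], so the twist depends on the field
    coordinate of [y] alone. *)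
Lemma full_twistU x y i : x.1.1 = 0 ->
  (twist x y).1.2 0 i = x.1.2 0 i * (sg i y.1.1 - y.1.1 ^+ (p ^ e)).
Proof.
move=> x0; transitivity ((x * y).1.2 0 i - (y ^+ (p ^ e) * x).1.2 0 i).
  by rewrite !mxE.
rewrite !full_mulU x0 rmorph0 mul0r mulr0 add0r addr0 full_exp1 mulrBr.
by rewrite [in X in _ - X = _]mulrC.
Qed.

Lemma full_twistN x y k : x.1.1 = 0 -> x.1.2 = 0 ->
  (twist x y).2 0 k = x.2 0 k * (theta k y.1.1 - y.1.1 ^+ (p ^ e)).
Proof.
move=> x0 xU; transitivity ((x * y).2 0 k - (y ^+ (p ^ e) * x).2 0 k).
  by rewrite !mxE.
rewrite !full_mulN0; [|by right|by left].
rewrite x0 rmorph0 mul0r mulr0 add0r addr0 full_exp1 mulrBr.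
by rewrite [in X in _ - X = _]mulrC.
Qed.

(** If [sg i] differs from the power map at some scalar [a], the twist by [a], multiplied by
    [u_elt i], forces the i-th coordinate to vanish. Conversely the twists then lie in N, which
    annihilates the radical; the N part of [x] stays arbitrary. *)
Lemma full_twisted_mod_ann x : (x \in twisted_mod_ann p e R) =
  (x.1.1 == 0) && [forall i, acts_as_frob (sg i) || (x.1.2 0 i == 0)].
Proof.
rewrite in_set full_cube_zero; have [x0 /=|//] := eqVneq.
apply/forallP/forallP=> H.
  move=> i; case: (boolP (acts_as_frob _)) => //= /acts_as_frobPn[a fa].
  have /forall_inP/(_ (u_elt i)) := H (scal_elt a).
  rewrite full_cube_zero eqxx => /(_ isT)/eqP.
  move/(congr1 (fun z : R => z.2 0 (lshift lam (mxvec_index i i)))) => /eqP.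
  rewrite full_mul_u ?full_twist1 // full_twistU // mxE mulf_eq0 (negPf fa).
  by rewrite orbF.
move=> a; apply/forall_inP=> y; rewrite full_cube_zero => /eqP y0; apply/eqP.
apply: full_mul_ann => //; first exact: full_twist1.
apply/rowP=> i; rewrite full_twistU // [RHS]mxE; have /orP[|/eqP->] := H i.
  by move/forallP/(_ a.1.1)/eqP->; rewrite subrr mulr0.
by rewrite mul0r.
Qed.

(** Annihilating each [u_elt i] removes the U part; on N the twist is diagonal, so each coordinate
    is tested separately against [theta k]. *)
Lemma full_twisted_in_ann x : (x \in twisted_in_ann p e R) =
  (x.1 == 0) && [forall k, acts_as_frob (theta k) || (x.2 0 k == 0)].
Proof.
rewrite in_set full_cube_zero.
have -> : (x.1 == 0) = (x.1.1 == 0) && (x.1.2 == 0) by case: x => -[].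
have [x0 /=|//] := eqVneq x.1.1.
have -> : [forall y in cube_zero R, x * y == 0] = (x.1.2 == 0).
  apply/forall_inP/eqP=> [H|xU y]; last first.
    by rewrite full_cube_zero => /eqP y0; rewrite full_mul_ann.
  apply/rowP=> i; have := H (u_elt i).
  rewrite full_cube_zero eqxx => /(_ isT)/eqP.
  move/(congr1 (fun z : R => z.2 0 (lshift lam (mxvec_index i i)))).
  by rewrite full_mul_u // !mxE.
have [xU /=|//] := eqVneq x.1.2; apply/forallP/forallP=> H.
  move=> k; case: (boolP (acts_as_frob _)) => //= /acts_as_frobPn[a fa].
  have := H (scal_elt a); rewrite -subr_eq0 => /eqP.
  move/(congr1 (fun z : R => z.2 0 k)) => /eqP.
  by rewrite full_twistN // mxE mulf_eq0 (negPf fa) orbF.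
move=> a; rewrite -subr_eq0; apply/eqP.
have tw0 k : (twist x a).2 0 k = 0.
  rewrite full_twistN //; have /orP[|/eqP->] := H k; last by rewrite mul0r.
  by move/forallP/(_ a.1.1)/eqP->; rewrite subrr mulr0.
apply/full_eq0P; split=> // [|i]; first exact: full_twist1.
by rewrite full_twistU // xU mxE mul0r.
Qed.

Lemma card_full_twisted_mod_ann : #|twisted_mod_ann p e R| =
  (#|F| ^ #|[pred i | acts_as_frob (sg i)]| * #|F| ^ (s * s + lam))%N.
Proof.
rewrite -(card_row_support F [pred i | acts_as_frob (sg i)]).
set A := [set u | _].
have <- : #|{: 'rV[F]_(s * s + lam)}| = (#|F| ^ (s * s + lam))%N.
  by rewrite card_mx mul1n.
transitivity #|setX (setX [set (0 : F)] A) [set: 'rV[F]_(s * s + lam)]|.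
  apply: eq_card => x; rewrite full_twisted_mod_ann.
  by rewrite /A !inE andbT.
by rewrite !cardsX cards1 mul1n cardsT.
Qed.

Lemma card_full_twisted_in_ann : #|twisted_in_ann p e R| =
  (#|F| ^ #|[pred k | acts_as_frob (theta k)]|)%N.
Proof.
rewrite -(card_row_support F [pred k | acts_as_frob (theta k)]).
set A := [set u | _].
transitivity #|setX [set (0 : F * 'rV[F]_s)] A|; last first.
  by rewrite cardsX cards1 mul1n.
by apply: eq_card => x; rewrite full_twisted_in_ann /A !inE.
Qed.

(** The part coming from the matrix units depends on [sg] only, so it cancels when two rings share
    the same sigma_i. *)
Lemma card_acts_theta : #|[pred k | acts_as_frob (theta k)]| =
  (\sum_(i < s) \sum_(j < s) acts_as_frob (sg i \o sg j)
   + #|[pred l | acts_as_frob (ta l)]|)%N.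
Proof.
rewrite -!sum1_card big_mkcond big_split_ord /=; congr (_ + _)%N; last first.
  rewrite [RHS]big_mkcond; apply: eq_bigr => l _.
  by rewrite !inE full_theta_rshift.
rewrite pair_bigA (reindex (fun ij => mxvec_index ij.1 ij.2)) /=.
  apply: eq_bigr => -[i j] _ /=; rewrite inE.
  rewrite (_ : acts_as_frob _ = acts_as_frob (sg i \o sg j)).
    by case: ifP.
  by apply: eq_forallb => a; rewrite full_theta_lshift.
exists (@mxvec_pair s) => [[i j]|k] _; first by rewrite mxvec_pairK.
by case/mxvec_indexP: k => i j; rewrite mxvec_pairK.
Qed.

End Cardinals.

(** The products u_i u_j and u_j u_i are distinct basis vectors of N. *)
Lemma full_noncommutative_u (i j : 'I_s) : i != j -> noncommutative R.
Proof.
move=> ij /(_ (u_elt i) (u_elt j)).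
move/(congr1 (fun z : R => z.2 0 (lshift lam (mxvec_index i j)))).
rewrite full_mul_uu full_mulN /= !mxE (negPf ij) !mul0r !add0r => /eqP.
by rewrite oner_eq0.
Qed.

Lemma full_noncommutative_sg i a : sg i a != a -> noncommutative R.
Proof.
move=> ai /(_ (u_elt i) (scal_elt a)) /(congr1 (fun z : R => z.1.2 0 i)).
rewrite !full_mulU /= !mxE !eqxx /= mul0r !mul1r mulr1 !add0r mul0r addr0.
by move/eqP; rewrite (negPf ai).
Qed.

Lemma full_noncommutative_ta l a : ta l a != a -> noncommutative R.
Proof.
move=> al /(_ (w_elt (rshift _ l)) (scal_elt a)).
move/(congr1 (fun z : R => z.2 0 (rshift _ l))).
rewrite !full_mulW /= !mxE !eqxx /= mul0r !mul1r mulr1 !add0r mul0r addr0.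
by move/eqP; rewrite (negPf al).
Qed.

End FullRing.

(** With one basis vector in U and trivial automorphisms, the multiplication is symmetric in its two
    arguments; this is the only source of commutative rings below. *)
Lemma full_commutative (F : finFieldType) lam
    (sg : 'I_1 -> {rmorphism F -> F}) (ta : 'I_lam -> {rmorphism F -> F}) :
  (forall i, sg i =1 id) -> (forall l, ta l =1 id) ->
  commutative (@GRing.mul (constrA (full_data sg ta))).
Proof.
move=> sg1 ta1 x y; apply/full_eqP; split=> [|i|i j|l].
- by rewrite !full_mul1 mulrC.
- by rewrite !full_mulU !sg1 addrC mulrC [X in _ + X]mulrC.
- rewrite !full_mulN !sg1 !(ord1 i) !(ord1 j) [X in _ = X + _]addrC.
  by congr (_ + _ + _); rewrite mulrC.
- by rewrite !full_mulW !ta1 addrC mulrC [X in _ + X]mulrC.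
Qed.

(** * Classification *)

(** Sorted tuples are canonical representatives of multisets, hence determined by multiplicities. *)
Lemma sorted_ord_tuple_eq m n (t1 t2 : m.-tuple 'I_n) :
  sorted leq (map val t1) -> sorted leq (map val t2) ->
  (forall e, count_mem e t1 = count_mem e t2) -> t1 = t2.
Proof.
move=> s1 s2 eq_c; apply/val_inj/(inj_map val_inj).
apply: (sorted_eq leq_trans anti_leq) => //.
by apply: perm_map; apply/allP=> e _ /=; rewrite eq_c.
Qed.

(** The sorting permutation is kept because the isomorphism [full_map] renumbers basis vectors by
    it. *)
Lemma sorted_ord_tuple_ex m n (t : m.-tuple 'I_n) :
  exists (t' : m.-tuple 'I_n) (pi : 'S_m), sorted leq (map val t') /\
    forall i, tnth t i = tnth t' (pi i).
Proof.
pose le := relpre (val : 'I_n -> nat) leq.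
have le_total : total le by move=> i j; apply: leq_total.
exists [tuple of sort le t].
have /tuple_permP[pi Dt] : perm_eq t [tuple of sort le t].
  by rewrite perm_sym perm_sort.
exists pi; split; first by rewrite /= sorted_map sort_sorted.
by move=> i; rewrite {1}(val_inj Dt : t = _) tnth_mktuple.
Qed.

(** * Rings indexed by tuples of Frobenius exponents *)

Section FrobeniusData.

Variables (F : finFieldType) (p r s lam : nat) (charFp : p \in [pchar F]).
Hypothesis cardF : #|F| = (p ^ r)%N.
Hypothesis s_gt0 : (0 < s)%N.
Implicit Types (c : s.-tuple 'I_r) (d : lam.-tuple 'I_r).

Definition frob_data c d : constrA_data F s (s * s) lam :=
  full_data (fun i => frob charFp (tnth c i)) (fun l => frob charFp (tnth d l)).

Lemma acts_as_frob_exp (e e' : 'I_r) :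
  acts_as_frob p e (frob charFp e') = (e' == e).
Proof.
apply/forallP/eqP=> [H|-> a]; last exact/eqxx.
by apply: (frob_inj (charFp := charFp) cardF) => a; apply/eqP/H.
Qed.

Lemma card_tnth_eq m (t : m.-tuple 'I_r) e :
  #|[pred i | tnth t i == e]| = count_mem e t.
Proof. by rewrite -sum1_card -sum1_count big_tuple. Qed.

Lemma card_acts_as_frob m (t : m.-tuple 'I_r) (e : 'I_r) :
  #|[pred i | acts_as_frob p e (frob charFp (tnth t i))]| = count_mem e t.
Proof.
by rewrite -card_tnth_eq; apply: eq_card => i; rewrite !inE acts_as_frob_exp.
Qed.

Lemma frob_data_iso_inj c c' d d' :
  sorted leq (map val c) -> sorted leq (map val c') ->
  sorted leq (map val d) -> sorted leq (map val d') ->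
  ring_iso (constrA (frob_data c d)) (constrA (frob_data c' d')) ->
  c = c' /\ d = d'.
Proof.
move=> sc sc' sd sd' [f bij_f]; have F_gt1 := finNzRing_gt1 F.
have ec : c = c'.
  apply: sorted_ord_tuple_eq => // e; apply/eqP.
  have /eqP := twisted_mod_ann_bij p e bij_f.
  rewrite !card_full_twisted_mod_ann eqn_pmul2r ?expn_gt0 1?ltnW //.
  by rewrite eqn_exp2l // !card_acts_as_frob.
(* Once [c] is known to equal [c'], the matrix units contribute equally to the second invariant, and
   only the multiplicities in [d] and [d'] remain. *)
split=> //; rewrite -{}ec {c' sc'} in f bij_f *.
apply: sorted_ord_tuple_eq => // e; apply/eqP.
have /eqP := twisted_in_ann_bij p e bij_f.
rewrite !card_full_twisted_in_ann eqn_exp2l // !card_acts_theta eqn_add2l.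
by rewrite !card_acts_as_frob.
Qed.

Lemma frob_data_invariants n c d : prime p -> n = (1 + s + s * s + lam)%N ->
  T_ring_with_invariants p n r s (s * s) lam (constrA (frob_data c d)).
Proof.
move=> p_pr Dn; split; first exact: full_property_T.
  exact: full_pchar.
split=> //; first by rewrite muln_gt0 s_gt0 mulnn leqnn.
by exists F, (frob_data c d); split=> //; apply: ring_iso_refl.
Qed.

(** The ring [R] comes with its own field [K] of order [p ^ r]. The data can be moved to the fixed
    field [F] because Frobenius powers are given by the same formula over both. *)
Lemma frob_data_exhaustive n R : prime p ->
  T_ring_with_invariants p n r s (s * s) lam R ->
  exists c d, [/\ sorted leq (map val c), sorted leq (map val d)
                & ring_iso R (constrA (frob_data c d))].
Proof.
move=> p_pr [_ _ [_ _ _ [K [D [cardK isoR]]]]].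
have charKp := card_finPcharP cardK p_pr.
have [phi _] := finField_card_hom p_pr cardF cardK.
have endo m (f : 'I_m -> {rmorphism K -> K}) :
    exists t : m.-tuple 'I_r, forall i, f i =1 frob charKp (tnth t i).
  have [e De] := @fin_all_exists _ (fun=> 'I_r)
    (fun i e => f i =1 frob charKp e)
    (fun i => finField_endo_frob charKp (f i) cardK).
  by exists [tuple e i | i < m] => i x; rewrite tnth_mktuple De.
have [c0 Dc0] := endo _ (cA_sigma D).
have [d0 Dd0] := endo _ (fun l => cA_theta D (rshift _ l)).
have [c [pi [sc Dc]]] := sorted_ord_tuple_ex c0.
have [d [rho [sd Dd]]] := sorted_ord_tuple_ex d0.
exists c, d; split=> //; apply: ring_iso_trans isoR _; apply: ring_iso_sym.
(* The standard ring over [F] is the source and the given ring over [K] the target; [phi] commutes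
   with powers, so it intertwines the automorphisms. *)
apply: (full_data_iso (phi := phi) _ (pi := pi) (rho := rho)).
- by rewrite cardF cardK.
- by move=> i x; rewrite Dc0 Dc (frobE charKp) (frobE charFp) rmorphXn.
- by move=> l x; rewrite Dd0 Dd (frobE charKp) (frobE charFp) rmorphXn.
Qed.

(** The identity is the power map of exponent 0, and distinct exponents below [r] give distinct
    maps. *)
Lemma frob_neq_id (e : 'I_r) : e != 0 :> nat -> exists a, frob charFp e a != a.
Proof.
move=> e0; apply/existsP; apply: contraNT e0.
rewrite negb_exists => /forallP He.
have r_gt0 : (0 < r)%N by apply: leq_ltn_trans (ltn_ord e).
suff -> : e = Ordinal r_gt0 by [].
apply: (frob_inj (charFp := charFp) cardF) => a; rewrite (eqP (negbNE (He a))).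
by rewrite (frobE charFp).
Qed.

Lemma frob_data_noncommutative c d :
  [exists i, tnth c i != 0 :> nat] || [exists l, tnth d l != 0 :> nat] ->
  noncommutative (constrA (frob_data c d)).
Proof.
case/orP=> /existsP[i /frob_neq_id[a fa]].
  exact: (full_noncommutative_sg (i := i) fa).
exact: (full_noncommutative_ta (l := i) fa).
Qed.

End FrobeniusData.

Local Close Scope ring_scope.

(** For s = 1 the choice of trivial automorphisms throughout gives a commutative ring.
    Non-commutativity is therefore stated without exception for s > 1, and for s = 1 with exactly
    one exceptional isomorphism class. *)
Theorem lemma5p3 (p n r s t lam : nat) (hp : prime p) (hr : 0 < r) (hs : 0 < s)
    (hn : n = 1 + s + t + lam) (ht : t = s ^ 2) :
  [/\ iso_class_number (T_ring_with_invariants p n r s t lam)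
        ('C(r + s - 1, s) * 'C(r + lam - 1, lam)),
      1 < s -> forall R : finNzRingType,
        T_ring_with_invariants p n r s t lam R -> noncommutative R
    & s = 1 -> exists R0 : finNzRingType,
        [/\ T_ring_with_invariants p n r s t lam R0, ~ noncommutative R0
          & forall R : finNzRingType, T_ring_with_invariants p n r s t lam R ->
              ~ ring_iso R R0 -> noncommutative R]].
Proof.
have {ht}ht : t = s * s by rewrite ht mulnn.
subst t; case: r hr => // r' _.
have [F charF cardF] := pPrimePowerField hp (ltn0Sn r').
pose I := setX [set c : s.-tuple 'I_r'.+1 | sorted leq (map val c)]
               [set d : lam.-tuple 'I_r'.+1 | sorted leq (map val d)].
pose X (cd : s.-tuple 'I_r'.+1 * lam.-tuple 'I_r'.+1) : finNzRingType :=
  constrA (frob_data charF cd.1 cd.2).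
have XT cd : T_ring_with_invariants p n r'.+1 s (s * s) lam (X cd).
  exact: frob_data_invariants.
have TX R : T_ring_with_invariants p n r'.+1 s (s * s) lam R ->
    exists2 cd, cd \in I & ring_iso R (X cd).
  case/(frob_data_exhaustive charF cardF hp) => c [d [sc sd isoR]].
  by exists (c, d); rewrite // !inE sc sd.
split.
(* Sorted m-tuples over [r'.+1] values number 'C(m + r', m), which is 'C(r + m - 1, m) for r = r' +
   1. *)
- have cardI : #|I| = 'C(r'.+1 + s - 1, s) * 'C(r'.+1 + lam - 1, lam).
    by rewrite cardsX !card_sorted_tuples !addSn !subn1 /= ![r' + _]addnC.
  rewrite -cardI; exists (fun i => X (enum_val i)); split=> [i|i j isoij|R].
  + exact: XT.
  + apply: enum_val_inj; move: isoij (enum_valP i) (enum_valP j).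
    case: (enum_val i) (enum_val j) => [c d] [c' d'] iso; rewrite !inE /=.
    case/andP=> sc sd /andP[sc' sd'].
    by have [-> ->] := frob_data_iso_inj cardF sc sc' sd sd' iso.
  + case/TX=> cd Icd isoR; exists (enum_rank_in Icd cd).
    by rewrite enum_rankK_in.
- move=> s_gt1 R /TX[cd _ isoR]; apply: noncommutative_iso isoR _.
  exact: (@full_noncommutative_u _ _ _ _ _ (Ordinal hs) (Ordinal s_gt1)).
move=> s1; subst s.
(* Exponent 0 everywhere means that all automorphisms are trivial: this is the commutative
   exception. *)
pose cd0 : 1.-tuple 'I_r'.+1 * lam.-tuple 'I_r'.+1 :=
  ([tuple ord0 | i < 1], [tuple ord0 | i < lam]).
exists (X cd0); split=> // [ncX|R /TX[[c d] _ isoR] not_isoR].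
  by apply: ncX; apply: full_commutative => i x; rewrite tnth_mktuple.
apply: (noncommutative_iso isoR); apply: frob_data_noncommutative => //.
(* If no exponent were nonzero, [(c, d)] would be [cd0] and [R] would be isomorphic to the
   exception. *)
apply: contra_notT not_isoR; rewrite negb_or !negb_exists.
case/andP=> /forallP c0 /forallP d0.
suff <- : (c, d) = cd0 by [].
congr (_, _); apply: eq_from_tnth => i; rewrite tnth_mktuple; apply/val_inj/eqP.
  exact/negbNE/c0.
exact/negbNE/d0.
Qed.
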